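(* Let $m\in\mathbb{N}$ with $m\geq 2$. For each $Y\in\mathbb{S}^m_+$, each $V\in\mathcal{T}_{\mathbb{S}^m_+}(Y)$, and each $Y^*\in\mathcal{N}_{\mathbb{S}^m_+}(Y)\cap\{V\}^\perp$, we have $$\mathrm{d}^2\delta_{\mathbb{S}^m_+}(Y,Y^* )(V)=-2\langle Y^*, V Y^\dagger V\rangle.$$
   Context: $\mathbb{S}^m$ is the Euclidean space of real symmetric $m\times m$ matrices with the Frobenius inner product $\langle A,B\rangle:=\operatorname{trace}(AB)$ and the induced norm; $\mathbb{S}^m_+\subset\mathbb{S}^m$ is the closed convex cone of positive semidefinite matrices. $Y^\dagger$ denotes the Moore--Penrose pseudoinverse of $Y$. For $V\in\mathbb{S}^m$, $\{V\}^\perp:=\{Z\in\mathbb{S}^m \mid \langle Z,V\rangle=0\}$. For a nonempty convex set $A$ in a Euclidean space (finite-dimensional real Hilbert space) $\mathbb{X}$ and $\bar x\in A$, the tangent (Bouligand) cone is $$\mathcal{T}_A(\bar x):=\{u\in\mathbb{X}\mid \exists \{t_k\}\subset(0,\infty),\ \exists\{u_k\}\subset\mathbb{X}:\ t_k\downarrow 0,\ u_k\to u,\ \bar x+t_ku_k\in A\ \text{for all } k\in\mathbb{N}\},$$ and the normal cone is its polar, $\mathcal{N}_A(\bar x):=\{x^*\in\mathbb{X}\mid \langle x^*,u\rangle\leq 0 \text{ for all } u\in\mathcal{T}_A(\bar x)\}$. For a lower semicontinuous function $\varphi:\mathbb{X}\to\mathbb{R}\cup\{\infty\}$, a point $\bar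 x\in\mathbb{X}$ with $\varphi(\bar x)<\infty$, and $x^*\in\mathbb{X}$, the second subderivative of $\varphi$ at $\bar x$ with $x^*$ is the function $\mathrm{d}^2\varphi(\bar x,x^* ):\mathbb{X}\to\mathbb{R}\cup\{-\infty,\infty\}$ given by $$\mathrm{d}^2\varphi(\bar x,x^* )(u):=\liminf_{t\downarrow 0,\ u'\to u}\frac{\varphi(\bar x+tu')-\varphi(\bar x)-t\langle x^*,u'\rangle}{t^2/2}.$$ For a closed convex set $A\subset\mathbb{X}$, $\delta_A:\mathbb{X}\to\mathbb{R}\cup\{\infty\}$ is the indicator function, with $\delta_A(x)=0$ if $x\in A$ and $\delta_A(x)=\infty$ if $x\notin A$. *)

(* Defs.v *)
From HB Require Import structures.
From mathcomp Require Import all_boot all_order all_algebra.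
From mathcomp Require Import all_classical all_reals all_analysis.
From mathcomp Require Import ring lra.

Set Implicit Arguments.
Unset Strict Implicit.
Unset Printing Implicit Defensive.

Import Order.TTheory GRing.Theory Num.Theory.
Import numFieldNormedType.Exports.

Local Open Scope classical_set_scope.
Local Open Scope ring_scope.

(* Real inner product spaces: the norm (hence the topology) is the one induced
   by the inner product.  Finite dimension is not part of the structure. *)

HB.mixin Record NormedModule_hasInner (R : realType) V
    & NormedModule R V := {
  inner : V -> V -> R ;
  innerC : forall x y, inner x y = inner y x ;
  innerDl : forall x y z, inner (x + y) z = inner x z + inner y z ;
  innerZl : forall a x y, inner (a *: x) y = a * inner x y ;
  norm_inner : forall x, `|x| = Num.sqrt (inner x x)
}.

#[short(type="innerSpaceType")]
HB.structure Definition InnerSpace (R : realType) :=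
  {V of NormedModule_hasInner R V & NormedModule R V}.

Section InducedNorm.
Variables (R : realType) (V : lmodType R) (f : V -> V -> R).
Hypothesis fC : forall x y, f x y = f y x.
Hypothesis fDl : forall x y z, f (x + y) z = f x z + f y z.
Hypothesis fZl : forall a x y, f (a *: x) y = a * f x y.
Hypothesis f_ge0 : forall x, 0 <= f x x.
Hypothesis f_eq0 : forall x, f x x = 0 -> x = 0.

Let fDr x y z : f z (x + y) = f z x + f z y.
Proof. by rewrite fC fDl !(fC z). Qed.

Let fZr a x y : f y (a *: x) = a * f y x.
Proof. by rewrite fC fZl fC. Qed.

Lemma inner_cauchy_schwarz x y : f x y ^+ 2 <= f x x * f y y.
Proof.
have [y0|ny0] := eqVneq (f y y) 0.
  have -> : f x y = 0 by rewrite (f_eq0 y0) -(scale0r 0) fZr mul0r.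
  by rewrite y0 mulr0 expr0n.
have ypos : 0 < f y y by rewrite lt_def ny0 f_ge0.
have := f_ge0 (f y y *: x + (- f x y) *: y).
rewrite !(fDl, fDr, fZl, fZr) (fC y x) => h.
rewrite -subr_ge0 -(pmulr_rge0 _ ypos).
apply: le_trans h _; rewrite le_eqVlt; apply/orP; left; apply/eqP.
by ring.
Qed.

Lemma induced_norm_triangle x y :
  Num.sqrt (f (x + y) (x + y)) <= Num.sqrt (f x x) + Num.sqrt (f y y).
Proof.
rewrite -ler_sqr ?nnegrE ?addr_ge0 ?sqrtr_ge0//.
rewrite sqrrD !sqr_sqrtr// !(fDl, fDr) (fC y x).
have : f x y <= Num.sqrt (f x x) * Num.sqrt (f y y).
  rewrite -sqrtrM//; apply: le_trans (ler_norm _) _.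
  by rewrite -sqrtr_sqr ler_wsqrtr// inner_cauchy_schwarz.
by rewrite mulr2n; lra.
Qed.

Lemma induced_norm_scale a x :
  Num.sqrt (f (a *: x) (a *: x)) = `|a| * Num.sqrt (f x x).
Proof. by rewrite fZl fZr mulrA -expr2 sqrtrM ?sqr_ge0// sqrtr_sqr. Qed.

Lemma induced_norm_eq0 x : Num.sqrt (f x x) = 0 -> x = 0.
Proof.
move=> /eqP; rewrite sqrtr_eq0 => h; apply: f_eq0.
by apply/eqP; rewrite eq_le h f_ge0.
Qed.

End InducedNorm.

Section Variational.
Context {R : realType} {X : innerSpaceType R}.
Implicit Types (A : set X) (x u v : X).

Definition tangent_cone A x : set X :=
  [set u | exists t : R^nat, exists u_ : X^nat,
    [/\ (forall k, 0 < t k), t @ \oo --> (0 : R), u_ @ \oo --> u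
      & forall k, A (x + t k *: u_ k)]].

Definition normal_cone A x : set X :=
  [set x' | forall u, tangent_cone A x u -> inner x' u <= 0].

Definition orthogonal_to v : set X := [set z | inner z v = 0].

Definition convex_indicator A (x : X) : \bar R :=
  if x \in A then 0%E else +oo%E.

Definition second_subderivative (phi : X -> \bar R) (x x' u : X) : \bar R :=
  limf_einf
    (fun p : R * X =>
       (phi (x + p.1 *: p.2)%R - phi x - (p.1 * inner x' p.2)%:E)
         / (p.1 ^+ 2 / 2)%:E)%E
    (filter_prod (0^'+) (nbhs u)).

End Variational.

Section Matrices.
Variable R : realType.

Definition frobenius m (A B : 'M[R]_m) : R := \tr (A *m B).

Definition is_moore_penrose m n (A : 'M[R]_(m, n)) (P : 'M[R]_(n, m)) : Prop :=
  [/\ A *m P *m A = A, P *m A *m P = P,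
      (A *m P)^T = A *m P & (P *m A)^T = P *m A].

(* Not to be confused with [pinvmx], which is only a partial inverse. *)
Definition moore_penrose m n (A : 'M[R]_(m, n)) : 'M[R]_(n, m) :=
  xget 0 [set P | is_moore_penrose A P].

Lemma is_moore_penrose_unique m n (A : 'M[R]_(m, n)) P Q :
  is_moore_penrose A P -> is_moore_penrose A Q -> P = Q.
Proof.
move=> [p1 p2 p3 p4] [q1 q2 q3 q4].
have AP : A *m P = A *m Q.
  rewrite -p3 -[in LHS]q1 -(mulmxA (A *m Q)) trmx_mul p3 q3.
  by rewrite mulmxA p1.
have PA : P *m A = Q *m A.
  rewrite -p4 -[in LHS]q1 -!mulmxA (mulmxA P) trmx_mul q4 p4.
  by rewrite -!mulmxA (mulmxA A P) p1.
by rewrite -p2 PA -mulmxA AP mulmxA q2.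
Qed.

Lemma trmx_mul_eq0 m n (B : 'M[R]_(m, n)) : B *m B^T = 0 -> B = 0.
Proof.
move=> h; apply/matrixP => i j; rewrite mxE.
have /matrixP/(_ i i) := h; rewrite !mxE => /eqP.
rewrite psumr_eq0; last by move=> k _; rewrite mxE -expr2 sqr_ge0.
by move=> /allP/(_ j (mem_index_enum _)); rewrite mxE -expr2 sqrf_eq0 => /eqP.
Qed.

Lemma gram_unitmx m n (B : 'M[R]_(m, n)) : row_free B -> B *m B^T \in unitmx.
Proof.
move=> Bfree; rewrite -row_free_unit; apply: inj_row_free => v vB0.
have : v *m B = 0.
  by apply: trmx_mul_eq0; rewrite trmx_mul mulmxA -(mulmxA v) vB0 mul0mx.
by move=> /eqP; rewrite mulmx_free_eq0// => /eqP.
Qed.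

Lemma is_moore_penrose_exists m n (A : 'M[R]_(m, n)) :
  exists P, is_moore_penrose A P.
Proof.
have [r [C [B [-> GB GC]]]] : exists r (C : 'M[R]_(m, r)) (B : 'M[R]_(r, n)),
    [/\ A = C *m B, B *m B^T \in unitmx & C^T *m C \in unitmx].
  exists (\rank A), (col_base A), (row_base A); split.
  - by rewrite mulmx_base.
  - exact/gram_unitmx/row_base_free.
  - have := @gram_unitmx _ _ (col_base A)^T; rewrite trmxK; apply.
    by rewrite /row_free mxrank_tr; exact: col_base_full.
pose iB := invmx (B *m B^T); pose iC := invmx (C^T *m C).
have tB : iB^T = iB by rewrite trmx_inv trmx_mul trmxK.
have tC : iC^T = iC by rewrite trmx_inv trmx_mul trmxK.
pose P := B^T *m iB *m iC *m C^T.
have AP : C *m B *m P = C *m iC *m C^T.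
  rewrite /P !mulmxA -(mulmxA C B) -(mulmxA C (B *m B^T)).
  by rewrite mulmxV// mulmx1.
have PA : P *m (C *m B) = B^T *m iB *m B.
  rewrite /P !mulmxA -(mulmxA _ C^T C) -(mulmxA _ iC).
  by rewrite mulVmx// mulmx1.
exists P; split.
- rewrite AP !mulmxA -(mulmxA _ C^T C) -(mulmxA _ iC).
  by rewrite mulVmx// mulmx1.
- rewrite PA /P !mulmxA -(mulmxA _ B B^T) -(mulmxA _ iB (B *m _)).
  by rewrite mulVmx// mulmx1.
- by rewrite AP !trmx_mul tC trmxK mulmxA.
- by rewrite PA !trmx_mul tB trmxK mulmxA.
Qed.

Lemma moore_penroseP m n (A : 'M[R]_(m, n)) :
  is_moore_penrose A (moore_penrose A).
Proof.
exact: (@xgetPex _ 0 [set P | is_moore_penrose A P]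
  (is_moore_penrose_exists A)).
Qed.

End Matrices.

Section SymPred.
Variables (R : realType) (m : nat).

Definition sym_pred : {pred 'M[R]_m} := [pred A | A^T == A].

Fact sym_submod_closed : submod_closed sym_pred.
Proof.
split; first by rewrite inE /= trmx0.
move=> a A B; rewrite !inE /= => /eqP hA /eqP hB.
by rewrite linearD linearZ /= hA hB.
Qed.

HB.instance Definition _ :=
  GRing.isSubmodClosed.Build R 'M[R]_m sym_pred sym_submod_closed.

Record symmx := SymMx { symmx_val :> 'M[R]_m ; _ : symmx_val \in sym_pred }.

HB.instance Definition _ := [isSub for symmx_val].
HB.instance Definition _ := [Choice of symmx by <:].
HB.instance Definition _ := [SubChoice_isSubLmodule of symmx by <:].

Fact symmx_valD (A B : symmx) :
  symmx_val (A + B) = symmx_val A + symmx_val B.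
Proof. exact: (raddfD (val : symmx -> 'M[R]_m)). Qed.

Fact symmx_valZ a (A : symmx) : symmx_val (a *: A) = a *: symmx_val A.
Proof. exact: (linearZZ (val : symmx -> 'M[R]_m)). Qed.

Fact symmx_val0 : symmx_val 0 = 0.
Proof. exact: (raddf0 (val : symmx -> 'M[R]_m)). Qed.

Definition sym_inner (A B : symmx) : R := frobenius A B.

Fact sym_innerC A B : sym_inner A B = sym_inner B A.
Proof. exact: mxtrace_mulC. Qed.

Fact sym_innerDl A B C :
  sym_inner (A + B) C = sym_inner A C + sym_inner B C.
Proof. by rewrite /sym_inner /frobenius symmx_valD mulmxDl mxtraceD. Qed.

Fact sym_innerZl a A B : sym_inner (a *: A) B = a * sym_inner A B.
Proof. by rewrite /sym_inner /frobenius symmx_valZ -scalemxAl mxtraceZ. Qed.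

Fact sym_inner_ge0 A : 0 <= sym_inner A A.
Proof.
rewrite /sym_inner /frobenius; case: A => A /= /eqP hA; rewrite -{2}hA.
rewrite sumr_ge0// => i _; rewrite mxE sumr_ge0// => j _.
by rewrite mxE -expr2 sqr_ge0.
Qed.

Fact sym_inner_eq0 A : sym_inner A A = 0 -> A = 0.
Proof.
move=> h; apply/val_inj; rewrite -[RHS]/(symmx_val 0) symmx_val0; move: h.
rewrite /sym_inner /frobenius; case: A => A /= /eqP hA; rewrite -{2}hA.
have sq i j : 0 <= A i j * A^T j i by rewrite mxE -expr2 sqr_ge0.
move=> /eqP; rewrite psumr_eq0; last first.
  by move=> i _; rewrite mxE sumr_ge0.
move=> /allP h; apply/matrixP => i j; rewrite mxE.
have := h i (mem_index_enum _); rewrite /= mxE psumr_eq0; last by [].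
by move=> /allP/(_ j (mem_index_enum _)); rewrite mxE -expr2 sqrf_eq0 => /eqP.
Qed.

HB.instance Definition _ := Lmodule_isNormed.Build R symmx
  (induced_norm_triangle sym_innerC sym_innerDl sym_innerZl
     sym_inner_ge0 sym_inner_eq0)
  (induced_norm_scale sym_innerC sym_innerZl)
  (induced_norm_eq0 sym_inner_ge0 sym_inner_eq0).

HB.instance Definition _ := NormedModule_hasInner.Build R symmx
  sym_innerC sym_innerDl sym_innerZl (fun=> erefl).

Definition psd_cone : set symmx :=
  [set A : symmx | forall x : 'cV[R]_m, 0 <= (x^T *m A *m x) 0 0].

End SymPred.

Arguments psd_cone : clear implicits.

(* Main.v *)
Require Import Defs.
From HB Require Import structures.
From mathcomp Require Import all_boot all_order all_algebra.
From mathcomp Require Import all_classical all_reals all_analysis.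
From mathcomp Require Import ring lra.

Set Implicit Arguments.
Unset Strict Implicit.
Unset Printing Implicit Defensive.

Import Order.TTheory GRing.Theory Num.Theory.
Import numFieldNormedType.Exports.

Local Open Scope classical_set_scope.
Local Open Scope ring_scope.

(** On a set A, the difference quotient of the indicator at (t, W) is
    -2 <Ys, W> / t, and off A it is infinite.  So the second subderivative is
    the lower limit of -2 <Ys, W> / t over pairs (t, W) tending to (0, V) with
    Y + tW positive semidefinite.  Write P for the pseudoinverse of Y.

    Everything is driven by two facts on a normal vector Ys.  It is nonpositive
    on the cone and annihilates Y ([normal_psd_le0], [normal_psd_ortho]);
    consequently it annihilates every WY and YW, since (1 + sW) Y (1 + sW)^T
    stays in the cone for s of both signs ([normal_psd_mulr],
    [normal_psd_mull]).

    Lower bound ([psd_lower_estimate], [psd_lower_limit]): pairing Ys with the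
    congruence of Y + tW by 1 - tWP removes the terms with Y at either end and
    leaves
      <Ys, W> / t <= <Ys, WPW> - t <Ys, WPWPW>,
    whose right-hand side tends to <Ys, VPV>; multiplying by -2 bounds the
    quotient from below.

    Attainment: with Q = YP the projector on the range of Y and
    X = (1 - Q/2) VP one has
      (1 + tX) Y (1 + tX)^T + t (1 - Q) V (1 - Q) = Y + t (V + t XYX^T).
    The left-hand side is positive semidefinite because a tangent direction V
    is nonnegative on the kernel of Y ([tangent_psd_ker]).  Since Ys is
    orthogonal to V and <Ys, XYX^T> = <Ys, VPV> ([recovery_curvature]), the
    quotient equals -2 <Ys, VPV> along the curve V + t XYX^T, for every t > 0. *)

(** * Second subderivatives of indicator functions *)

Section Indicator.
Context {R : realType} {X : innerSpaceType R}.
Implicit Types (A : set X) (x u : X).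

Let indicator_quotient A x x' (p : R * X) : \bar R :=
  ((convex_indicator A (x + p.1 *: p.2)%R - convex_indicator A x
     - (p.1 * inner x' p.2)%:E) / (p.1 ^+ 2 / 2)%:E)%E.

Lemma indicator_quotient_in A x x' (p : R * X) : A x -> 0 < p.1 ->
  A (x + p.1 *: p.2) ->
  (indicator_quotient A x x' p
   = (- 2 * inner x' p.2 / p.1)%R%:E)%E.
Proof.
move=> Ax p0 Ap; rewrite /indicator_quotient /convex_indicator.
rewrite (mem_set Ax) (mem_set Ap) sube0 sub0e.
have p1n0 : p.1 != 0 by rewrite gt_eqF.
rewrite inver ifF; last by apply/negbTE; rewrite mulf_neq0 ?sqrf_eq0 ?invr_eq0.
by rewrite -EFinN -EFinM; congr EFin; field.
Qed.

Lemma indicator_quotient_notin A x x' (p : R * X) : A x -> 0 < p.1 ->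
  ~ A (x + p.1 *: p.2) ->
  (indicator_quotient A x x' p = +oo)%E.
Proof.
move=> Ax p0 Ap; rewrite /indicator_quotient /convex_indicator.
rewrite (mem_set Ax) (memNset Ap) sube0.
rewrite inver ifF; last first.
  by apply/negbTE; rewrite mulf_neq0 ?invr_eq0// sqrf_eq0 gt_eqF.
by rewrite addye// gt0_mulye// lte_fin invr_gt0 divr_gt0// exprn_gt0.
Qed.

(** The quotient is infinite off A, so a lower bound is only required at
    feasible pairs, while a feasible curve on which the quotient does not
    exceed L bounds the lower limit from above. *)
Lemma second_subderivative_indicator A x x' u (w : R -> X) L :
  A x ->
  (forall e, 0 < e -> \forall p \near filter_prod (0 : R)^'+ (nbhs u),
     A (x + p.1 *: p.2) -> L - e <= - 2 * inner x' p.2 / p.1) ->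
  w @ (0 : R)^'+ --> u ->
  (\forall t \near (0 : R)^'+,
     A (x + t *: w t) /\ - 2 * inner x' (w t) / t <= L) ->
  second_subderivative (convex_indicator A) x x' u = L%:E.
Proof.
move=> Ax lower wu recov; rewrite /second_subderivative /limf_einf /limf_esup.
apply/eqP; rewrite eq_le; apply/andP; split; last first.
  apply/lee_subgt0Pr => e e0; rewrite leeNr.
  have [[P Q] [P0 Qu] PQ] := lower _ e0.
  (* The quotient is only controlled for positive t. *)
  pose P' := P `&` [set t | 0 < t].
  apply: (@le_trans _ _
    (ereal_sup ((\- indicator_quotient A x x')%E @` (P' `*` Q)))).
    apply: ereal_inf_lbound; exists (P' `*` Q) => //.
    exists (P', Q) => //; split=> //=.
    by apply: filterI => //; exact: nbhs_right_gt.
  apply: ge_ereal_sup => _ [p [[Pp p0] Qp] <-].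
  rewrite -[leLHS]/(- indicator_quotient A x x' p)%E leeN2.
  have [Ap|nAp] := pselect (A (x + p.1 *: p.2)); last first.
    by rewrite indicator_quotient_notin// leey.
  rewrite indicator_quotient_in// -EFinB lee_fin.
  exact: (PQ p).
rewrite leeNl; apply: le_ereal_inf_tmp => _ [B [[P Q] [P0 Qu] PQB] <-].
have [t [[Pt Qt] [t0 [At Lt]]]] : exists t, (P t /\ Q (w t)) /\
    (0 < t /\ (A (x + t *: w t) /\ - 2 * inner x' (w t) / t <= L)).
  apply: (@filter_ex _ ((0 : R)^'+)).
  near=> t; split; split.
  - by near: t.
  - by near: t; exact: (wu Q Qu).
  - by near: t; exact: nbhs_right_gt.
  - by near: t.
apply: le_trans (ereal_sup_ubound _); last first.
  by exists (t, w t); [exact: PQB | reflexivity].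
rewrite -[leRHS]/(- indicator_quotient A x x' (t, w t))%E leeN2.
by rewrite indicator_quotient_in//= lee_fin.
Unshelve. all: by end_near. Qed.

Lemma tangent_cone_sub A x b :
  (forall t, 0 < t -> t <= 1 -> A (x + t *: (b - x))) ->
  tangent_cone A x (b - x).
Proof.
move=> h; exists harmonic, (fun=> b - x); split=> [k|||k].
- exact: harmonic_gt0.
- exact: cvg_harmonic.
- exact: cvg_cst.
- by apply: h; rewrite ?invr_gt0// invf_le1 ?ler1n// ltr0n.
Qed.

End Indicator.

(** * Entrywise limits of matrices *)

Section EntrywiseLimits.
Context {R : realType} {T : Type} (G : set_system T) {FG : Filter G}.

(** Entrywise convergence follows from convergence in the Frobenius norm and is
    stable under products, so traces of polynomial expressions in symmetric
    matrices converge. *)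
Definition mx_cvg {m n} (F : T -> 'M[R]_(m, n)) (A : 'M[R]_(m, n)) :=
  forall i j, F x i j @[x --> G] --> A i j.

Lemma mx_cvg_cst {m n} (A : 'M[R]_(m, n)) : mx_cvg (fun=> A) A.
Proof. by move=> i j; exact: cvg_cst. Qed.

Lemma mx_cvgM {m n p} (F : T -> 'M[R]_(m, n)) (H : T -> 'M[R]_(n, p)) A B :
  mx_cvg F A -> mx_cvg H B -> mx_cvg (fun x => F x *m H x) (A *m B).
Proof.
move=> FA HB i j; rewrite mxE.
under eq_fun do rewrite mxE.
apply: (cvg_big add_continuous) => k _.
by apply: cvgM; [exact: FA | exact: HB].
Qed.

Lemma mx_cvg_tr {m} (F : T -> 'M[R]_m) A :
  mx_cvg F A -> \tr (F x) @[x --> G] --> \tr A.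
Proof. by move=> FA; apply: (cvg_big add_continuous) => k _; exact: FA. Qed.

End EntrywiseLimits.

(** * The positive semidefinite cone *)

Section SymmetricMatrices.
Context {R : realType} {m : nat}.
Local Notation S := (symmx R m).
Local Notation psd := (psd_cone R m).
Implicit Types (A B V W : S) (K X : 'M[R]_m).

Lemma symmx_tr A : (A : 'M[R]_m)^T = A.
Proof. by case: A => A /= /eqP. Qed.

Lemma tr_sym_flip A K : \tr (A *m K^T) = \tr (A *m K).
Proof. by rewrite -mxtrace_tr trmx_mul trmxK symmx_tr mxtrace_mulC. Qed.

Lemma symmx_innerE A B : inner A B = \tr (A *m B).
Proof. by []. Qed.

Lemma symmx_valB A B : symmx_val (A - B) = symmx_val A - symmx_val B.
Proof. exact: (raddfB (val : S -> 'M[R]_m)). Qed.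

Lemma entry_le_norm A i j : `|(A : 'M[R]_m) i j| <= `|A|.
Proof.
rewrite norm_inner -sqrtr_sqr ler_wsqrtr// symmx_innerE -{3}(symmx_tr A).
have sq k l : 0 <= (A : 'M[R]_m) k l * (A : 'M[R]_m)^T l k.
  by rewrite mxE -expr2 sqr_ge0.
rewrite /mxtrace (bigD1 i)//= mxE (bigD1 j)//= mxE -expr2 -addrA lerDl.
rewrite addr_ge0 ?sumr_ge0// => k _.
by rewrite mxE sumr_ge0.
Qed.

Lemma symmx_mx_cvg A : mx_cvg (nbhs A) (fun B : S => B : 'M[R]_m) A.
Proof.
move=> i j; apply/cvgrPdist_lt => e e0; near=> B.
have -> : (A : 'M[R]_m) i j - (B : 'M[R]_m) i j = ((A - B : S) : 'M[R]_m) i j.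
  by rewrite symmx_valB !mxE.
apply: le_lt_trans (entry_le_norm _ _ _) _.
by near: B; apply: cvgr_dist_lt.
Unshelve. all: by end_near. Qed.

Fact sym_congr_subproof K A : K *m A *m K^T \in @sym_pred R m.
Proof. by rewrite inE /= !trmx_mul trmxK symmx_tr mulmxA. Qed.

Definition sym_congr K A : S := SymMx (sym_congr_subproof K A).

Lemma sym_congrE K A : symmx_val (sym_congr K A) = K *m A *m K^T.
Proof. by []. Qed.

Lemma psd_congr K A : psd A -> psd (sym_congr K A).
Proof.
move=> pA x /=.
by have := pA (K^T *m x); rewrite trmx_mul trmxK !mulmxA.
Qed.

Lemma psd0 : psd 0.
Proof. by move=> x; rewrite symmx_val0 mulmx0 mul0mx mxE. Qed.

Lemma psdZ c A : 0 <= c -> psd A -> psd (c *: A).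
Proof.
move=> c0 pA x; rewrite symmx_valZ -scalemxAr -scalemxAl mxE.
by rewrite mulr_ge0.
Qed.

Lemma psdD A B : psd A -> psd B -> psd (A + B).
Proof.
move=> pA pB x; rewrite symmx_valD mulmxDr mulmxDl mxE.
by rewrite addr_ge0.
Qed.

Lemma congr_perturb K (t : R) X :
  (1%:M + t *: X) *m K *m (1%:M + t *: X)^T
  = K + t *: (X *m K + K *m X^T) + t ^+ 2 *: (X *m K *m X^T).
Proof.
rewrite linearD linearZ /= trmx1 mulmxDl mul1mx mulmxDr mulmx1.
rewrite mulmxDl -!scalemxAl -!scalemxAr scalerA scalerDr expr2 !addrA.
by congr (_ + _); rewrite -!addrA; congr (_ + _).
Qed.

(** If Yx = 0 then the form of Y + tU at x is t times that of U, so the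
    approximating directions are nonnegative at x, and so is their limit. *)
Lemma tangent_psd_ker Y V : tangent_cone psd Y V ->
  forall x : 'cV[R]_m, Y *m x = 0 -> 0 <= (x^T *m V *m x) 0 0.
Proof.
move=> [t [u [t0 _ uV pk]]] x Yx.
have cv : mx_cvg \oo (fun k => (u k : 'M[R]_m)) V.
  by move=> i j; exact: (cvg_comp _ _ uV (@symmx_mx_cvg V i j)).
have h : (x^T *m u k *m x) 0 0 @[k --> \oo] --> (x^T *m V *m x) 0 0.
  by apply: mx_cvgM; [apply: mx_cvgM => //|]; apply: mx_cvg_cst.
rewrite -(cvg_lim _ h)//; apply: limr_ge.
  by apply/cvg_ex; exists ((x^T *m V *m x) 0 0).
apply: nearW => k; have := pk k x.
rewrite symmx_valD symmx_valZ mulmxDr mulmxDl -mulmxA Yx mulmx0 add0r.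
by rewrite -scalemxAr -scalemxAl mxE pmulr_rge0.
Qed.

Lemma moore_penrose_sym (Y : S) :
  (moore_penrose (Y : 'M[R]_m))^T = moore_penrose (Y : 'M[R]_m).
Proof.
have [p1 p2 p3 p4] := moore_penroseP (Y : 'M[R]_m).
apply: (@is_moore_penrose_unique _ _ _ (Y : 'M[R]_m)); split=> //.
- by move/(congr1 trmx): p1; rewrite !trmx_mul !symmx_tr mulmxA.
- by move/(congr1 trmx): p2; rewrite !trmx_mul !symmx_tr mulmxA.
- by rewrite trmx_mul trmxK symmx_tr -p4 trmx_mul symmx_tr.
- by rewrite trmx_mul trmxK symmx_tr -p3 trmx_mul symmx_tr.
Qed.

Lemma moore_penrose_comm (Y : S) :
  Y *m moore_penrose (Y : 'M[R]_m) = moore_penrose (Y : 'M[R]_m) *m Y.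
Proof.
have [_ _ p3 _] := moore_penroseP (Y : 'M[R]_m).
by rewrite -{1}p3 trmx_mul moore_penrose_sym symmx_tr.
Qed.

(** * Normal vectors to the cone *)

Section Normal.
Variables (Y Ys : S).
Hypothesis (pY : psd Y) (nYs : normal_cone psd Y Ys).

Let le_feasible B : psd B -> inner Ys (B - Y) <= 0.
Proof.
move=> pB; apply: nYs; apply: tangent_cone_sub => t t0 t1.
have -> : Y + t *: (B - Y) = (1 - t) *: Y + t *: B.
  by rewrite scalerBr scalerBl scale1r addrA addrAC.
by apply: psdD; apply: psdZ => //; rewrite ?subr_ge0// ltW.
Qed.

(** Both -Y and Y are tangent at Y, as directions towards 0 and 2Y. *)
Lemma normal_psd_ortho : \tr (Ys *m Y) = 0.
Proof.
have h0 := le_feasible psd0; have := le_feasible (psdD pY pY).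
rewrite addrK symmx_innerE => h1; apply/eqP; rewrite eq_le h1 /=.
move: h0; rewrite symmx_innerE symmx_valB symmx_val0 sub0r mulmxN raddfN.
by rewrite oppr_le0.
Qed.

Lemma normal_psd_le0 B : psd B -> \tr (Ys *m B) <= 0.
Proof.
move=> /le_feasible; rewrite symmx_innerE symmx_valB mulmxBr raddfB.
by rewrite /= normal_psd_ortho subr0.
Qed.

(** Pairing Ys with (1 + sX) Y (1 + sX)^T, which lies in the cone, gives
    2 s a + s^2 c <= 0 for all real s, where a is the trace in question; hence
    a = 0. *)
Lemma normal_psd_mulr X : \tr (Ys *m (X *m Y)) = 0.
Proof.
set a := \tr _; pose c := \tr (Ys *m (X *m Y *m X^T)).
have key s : s * (2 * a) + s ^+ 2 * c <= 0.
  have := normal_psd_le0 (psd_congr (1%:M + s *: X) pY).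
  rewrite /= congr_perturb !mulmxDr !mxtraceD normal_psd_ortho add0r.
  rewrite -!scalemxAr !mxtraceZ mulmxDr mxtraceD.
  have -> : Y *m X^T = (X *m Y)^T by rewrite trmx_mul symmx_tr.
  by rewrite tr_sym_flip -/a -/c mulr2n mulrDl mul1r.
have c1 : 0 < `|c| + 1 by rewrite ltr_wpDl.
(* This s makes s (2 a) dominate s^2 c, with the sign of a. *)
have := key (a / (`|c| + 1)).
have -> : a / (`|c| + 1) * (2 * a) + (a / (`|c| + 1)) ^+ 2 * c
    = (a / (`|c| + 1)) ^+ 2 * (2 * (`|c| + 1) + c).
  by field; rewrite gt_eqF.
have cc : 0 < 2 * (`|c| + 1) + c by have := ler_norm (- c); rewrite normrN; lra.
rewrite pmulr_lle0// => h.
have : (a / (`|c| + 1)) ^+ 2 == 0 by rewrite eq_le h sqr_ge0.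
by rewrite sqrf_eq0 mulf_eq0 invr_eq0 (gt_eqF c1) orbF => /eqP.
Qed.

Lemma normal_psd_mull X : \tr (Ys *m (Y *m X)) = 0.
Proof.
have -> : Y *m X = (X^T *m Y)^T by rewrite trmx_mul trmxK symmx_tr.
by rewrite tr_sym_flip normal_psd_mulr.
Qed.

End Normal.

End SymmetricMatrices.

(** * Lower bound on the quotients *)

Section LowerBound.
Context {R : realType} {m : nat}.
Local Notation S := (symmx R m).
Local Notation psd := (psd_cone R m).
Variables (Y Ys : S).
Hypothesis (pY : psd Y) (nYs : normal_cone psd Y Ys).
Let P := moore_penrose (Y : 'M[R]_m).

(** The congruence of Y + tW by 1 - tWP lies in the cone, hence pairs
    nonpositively with Ys.  Its expansion has only the powers of W in the
    statement left: Y at either end is annihilated by Ys, and PYP = P. *)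
Lemma psd_lower_estimate (t : R) (W : S) : 0 < t -> psd (Y + t *: W) ->
  - 2 * \tr (Ys *m (W *m P *m W))
    + 2 * t * \tr (Ys *m (W *m P *m W *m P *m W))
  <= - 2 * inner Ys W / t.
Proof.
move=> t0 pW.
have PT : P^T = P by exact: moore_penrose_sym.
have PYP : P *m Y *m P = P by have [] := moore_penroseP (Y : 'M[R]_m).
have := normal_psd_le0 pY nYs (psd_congr (1%:M + (- t) *: (W *m P)) pW).
rewrite sym_congrE congr_perturb trmx_mul PT symmx_tr symmx_valD symmx_valZ.
rewrite !(mulmxDr, mulmxDl) -!(scalemxAr, scalemxAl) !(mxtraceD, mxtraceZ).
rewrite !(mulmxDr, mulmxDl) -!(scalemxAr, scalemxAl) !(mxtraceD, mxtraceZ).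
rewrite (normal_psd_ortho pY nYs) (normal_psd_mulr pY nYs).
rewrite (normal_psd_mull pY nYs) !mulmxA.
have -> : Ys *m W *m P *m Y *m P *m W = Ys *m W *m P *m W.
  by rewrite -(mulmxA _ P Y) -(mulmxA _ (P *m Y) P) PYP.
rewrite symmx_innerE; set a := \tr (Ys *m W); set b := \tr (_ *m P *m W).
set c := \tr _; rewrite !add0r ler_pdivlMr// => h.
have : t * (a - t * b + t ^+ 2 * c) <= 0.
  by apply: le_trans h; rewrite le_eqVlt; apply/orP; left; apply/eqP; ring.
rewrite pmulr_rle0// => h'; suff : 0 <= - 2 * (a - t * b + t ^+ 2 * c) by lra.
by rewrite mulNr oppr_ge0 pmulr_rle0.
Qed.

Lemma psd_lower_limit (V : S) (e : R) : 0 < e ->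
  \forall p \near filter_prod (0 : R)^'+ (nbhs V), psd (Y + p.1 *: p.2) ->
    - 2 * \tr (Ys *m (V *m P *m V)) - e <= - 2 * inner Ys p.2 / p.1.
Proof.
move=> e0; pose G := filter_prod (0 : R)^'+ (nbhs V).
have cW : mx_cvg G (fun p : R * S => p.2 : 'M[R]_m) V.
  by move=> i j; exact: (cvg_comp _ _ cvg_snd (@symmx_mx_cvg _ _ V i j)).
have cP : mx_cvg G (fun=> P) P by exact: mx_cvg_cst.
have cYs : mx_cvg G (fun=> Ys : 'M[R]_m) Ys by exact: mx_cvg_cst.
have cWPW : mx_cvg G (fun p : R * S => p.2 *m P *m p.2) (V *m P *m V).
  exact: mx_cvgM (mx_cvgM cW cP) cW.
have ct : (fun p : R * S => p.1) @ G --> (0 : R).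
  by apply: cvg_trans cvg_fst _; exact: cvg_within.
have lim : (fun p : R * S => - 2 * \tr (Ys *m (p.2 *m P *m p.2))
      + 2 * p.1 * \tr (Ys *m (p.2 *m P *m p.2 *m P *m p.2))) @ G
    --> - 2 * \tr (Ys *m (V *m P *m V)).
  rewrite -[X in _ --> X]addr0; apply: cvgD.
    by apply: cvgM; [exact: cvg_cst | exact: mx_cvg_tr (mx_cvgM cYs cWPW)].
  rewrite -(mul0r (\tr (Ys *m (V *m P *m V *m P *m V)))) -(mulr0 2).
  apply: cvgM; first by apply: cvgM; [exact: cvg_cst | exact: ct].
  exact: mx_cvg_tr (mx_cvgM cYs (mx_cvgM (mx_cvgM cWPW cP) cW)).
near=> p => pp.
apply: le_trans (psd_lower_estimate _ pp); last first.
  near: p; exists ([set t | 0 < t], setT) => /=; last by move=> p [].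
  by split; [exact: nbhs_right_gt | exact: filterT].
by near: p; apply: (cvgr_ge _ lim); rewrite ltrBlDr ltrDl.
Unshelve. all: by end_near. Qed.

End LowerBound.

(** * A feasible curve attaining the bound *)

Section Recovery.
Context {R : realType} {m : nat}.
Local Notation S := (symmx R m).
Local Notation psd := (psd_cone R m).
Variables (Y V : S).
Let P := moore_penrose (Y : 'M[R]_m).
Let Q := Y *m P.

(** A solution X of XY + YX^T = V - (1 - Q) V (1 - Q), the equation that makes
    the first-order term of (1 + tX) Y (1 + tX)^T agree with V away from the
    kernel block.  The factor 1/2 avoids counting the block QVQ twice. *)
Definition recovery_factor : 'M[R]_m := (1%:M - 2^-1 *: Q) *m V *m P.
Let X := recovery_factor.

Let PT : P^T = P. Proof. exact: moore_penrose_sym. Qed.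

Let QPY : Q = P *m Y. Proof. exact: moore_penrose_comm. Qed.

Let QT : Q^T = Q. Proof. by rewrite trmx_mul PT symmx_tr -QPY. Qed.

Lemma recovery_first_order :
  X *m Y + Y *m X^T + (1%:M - Q) *m V *m (1%:M - Q)^T = V.
Proof.
have -> : Y *m X^T = (X *m Y)^T by rewrite (trmx_mul X Y) symmx_tr.
have -> : X *m Y = V *m Q - 2^-1 *: (Q *m V *m Q).
  rewrite /X /recovery_factor -(mulmxA _ P) -QPY !mulmxBl mul1mx.
  by rewrite -!scalemxAl.
have -> : (V *m Q - 2^-1 *: (Q *m V *m Q))^T
    = Q *m V - 2^-1 *: (Q *m V *m Q).
  rewrite linearB /= [in LHS]linearZ /= (trmx_mul V Q) (trmx_mul (Q *m V) Q).
  by rewrite (trmx_mul Q V) QT symmx_tr mulmxA.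
rewrite linearB /= trmx1 QT !(mulmxBl, mulmxBr, mul1mx, mulmx1) !mulmxA.
set A := V *m Q; set B := Q *m V; set C := B *m Q.
by apply/matrixP => i j; rewrite !mxE; lra.
Qed.

(** Up to the kernel block t (1 - Q) V (1 - Q), which is in the cone by
    tangency of V, the point is a congruence of Y.  The second-order correction
    XYX^T is exactly the t^2 term of that congruence. *)
Lemma recovery_psd (t : R) : psd Y -> tangent_cone psd Y V -> 0 <= t ->
  psd (Y + t *: (V + t *: sym_congr X Y)).
Proof.
move=> pY tV t0.
have -> : Y + t *: (V + t *: sym_congr X Y)
    = sym_congr (1%:M + t *: X) Y + t *: sym_congr (1%:M - Q) V.
  apply/val_inj; rewrite -[LHS]/(symmx_val _) -[RHS]/(symmx_val _).
  rewrite !(symmx_valD, symmx_valZ) !sym_congrE.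
  rewrite congr_perturb -{1}recovery_first_order.
  rewrite !scalerDr scalerA -expr2 !addrA.
  by rewrite [RHS]addrAC.
apply: psdD; first exact: psd_congr.
apply: psdZ => // x; rewrite sym_congrE.
have := tangent_psd_ker tV (x := (1%:M - Q)^T *m x).
rewrite trmx_mul trmxK !mulmxA; apply.
have [YPY _ _ _] := moore_penroseP (Y : 'M[R]_m).
rewrite linearB /= trmx1 QT mulmxBr mulmx1 QPY mulmxA -/P.
by rewrite YPY subrr mul0mx.
Qed.

(** XYX^T = (1 - Q/2) VPV (1 - Q/2), and Ys annihilates whatever has Q at
    either end because Q = YP = PY. *)
Lemma recovery_curvature (Ys : S) : psd Y -> normal_cone psd Y Ys ->
  \tr (Ys *m sym_congr X Y) = \tr (Ys *m (V *m P *m V)).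
Proof.
move=> pY nYs; have [_ PYP _ _] := moore_penroseP (Y : 'M[R]_m).
have -> : symmx_val (sym_congr X Y)
    = (1%:M - 2^-1 *: Q) *m (V *m P *m V) *m (1%:M - 2^-1 *: Q).
  rewrite sym_congrE /X /recovery_factor (trmx_mul _ P) (trmx_mul _ V).
  rewrite PT symmx_tr.
  have -> : (1%:M - 2^-1 *: Q)^T = 1%:M - 2^-1 *: Q.
    by rewrite linearB /= [in LHS]linearZ /= trmx1 QT.
  rewrite !mulmxA.
  by rewrite -(mulmxA _ P Y) -(mulmxA _ (P *m Y) P) PYP.
move: (V *m P *m V) => D.
rewrite mulmxBr mulmx1 -scalemxAr mulmxBr -scalemxAr raddfB /= mxtraceZ.
rewrite {3}QPY (mulmxA _ P Y) (normal_psd_mulr pY nYs) mulr0 subr0.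
rewrite mulmxBl mul1mx -scalemxAl mulmxBr -scalemxAr raddfB /= mxtraceZ.
by rewrite -(mulmxA Y P D) (normal_psd_mull pY nYs) mulr0 subr0.
Qed.

End Recovery.

(** * The second subderivative *)

Unset Implicit Arguments.

Theorem lemma3p2 (R : realType) (m : nat) (hm : (2 <= m)%N)
    (Y : symmx R m) (hY : psd_cone R m Y)
    (V : symmx R m) (hV : tangent_cone (psd_cone R m) Y V)
    (Ys : symmx R m)
    (hYs : (normal_cone (psd_cone R m) Y `&` orthogonal_to V) Ys) :
  second_subderivative (convex_indicator (psd_cone R m)) Y Ys V
  = (- 2 * frobenius Ys (V *m moore_penrose Y *m V))%:E.
Proof.
have [nYs oYs] := hYs.
pose w (t : R) := V + t *: sym_congr (recovery_factor Y V) Y.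
apply: (second_subderivative_indicator (w := w)) => //.
- by move=> e; exact: psd_lower_limit.
- rewrite -[X in _ --> X]addr0 -(scale0r (sym_congr (recovery_factor Y V) Y)).
  apply: cvgD; first exact: cvg_cst.
  by apply: cvgZr_tmp; exact: cvg_within.
near=> t; have t0 : 0 < t by near: t; exact: nbhs_right_gt.
split; first by apply: recovery_psd => //; exact: ltW.
rewrite innerC innerDl innerZl !(innerC _ Ys) oYs add0r symmx_innerE.
by rewrite recovery_curvature// mulrA mulrAC mulfK ?gt_eqF.
Unshelve. all: by end_near. Qed.
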